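(* Let $\mathcal{K}\subseteq\mathbb{R}^n$ be a proper subdual cone, $\mathcal{S}=\mathbb{S}^{n-1}\cap\operatorname{int}(\mathcal{K})$, and $A=A^\top\in\mathbb{R}^{n\times n}$. The function $q_A:\mathcal{S}\to\mathbb{R}$, $q_A(x)=\langle Ax,x\rangle$, is spherically quasi-convex if and only if the function $\varphi_A:\operatorname{int}(\mathcal{K})\to\mathbb{R}$, $\varphi_A(x)=\langle Ax,x\rangle/\|x\|^2$, is quasi-convex.
   Context: $\mathbb{S}^{n-1}=\{x\in\mathbb{R}^n:\|x\|=1\}$. A proper cone is a pointed closed convex cone with nonempty interior; $\mathcal{K}^*=\{y:\langle x,y\rangle\ge0\ \forall x\in\mathcal{K}\}$; $\mathcal{K}$ is subdual if $\mathcal{K}\subseteq\mathcal{K}^*$. For $x,y\in\mathbb{S}^{n-1}$ with $y\ne\pm x$ the minimal geodesic from $x$ to $y$ is the constant-speed parametrization $\gamma_{xy}:[0,1]\to\mathbb{S}^{n-1}$ of the shorter great-circle arc from $x$ to $y$. The set $\mathcal{S}$ contains the minimal geodesic between any two of its points. A function $f:\mathcal{S}\to\mathbb{R}$ is spherically quasi-convex if for every minimal geodesic segment $\gamma:[0,1]\to\mathcal{S}$ the composition $f\circ\gamma$ is quasi-convex in the usual sense. Quasi-convexity of $\varphi_A$ is in the usual sense on the convex set $\operatorname{int}(\mathcal{K})$ (all sublevel sets are convex). *)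

(* Defs.v *)
From HB Require Import structures.
From mathcomp Require Import all_boot all_order all_algebra.
From mathcomp Require Import all_classical all_reals all_analysis.

Set Implicit Arguments.
Unset Strict Implicit.
Unset Printing Implicit Defensive.

Import Order.TTheory GRing.Theory Num.Theory.
Import numFieldNormedType.Exports.
Local Open Scope classical_set_scope.
Local Open Scope ring_scope.

(* The library norm `|x| on 'cV[R]_n is the sup norm, so the Euclidean norm is
   defined separately. The two are equivalent, so the library's [closed] and
   [interior] are the Euclidean ones. *)
Definition inner (R : realType) (n : nat) (x y : 'cV[R]_n) : R :=
  \sum_(i < n) x i 0 * y i 0.

Definition enorm (R : realType) (n : nat) (x : 'cV[R]_n) : R :=
  Num.sqrt (inner x x).

Definition sphere (R : realType) (n : nat) : set 'cV[R]_n :=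
  [set x | enorm x = 1].

Definition is_cone (R : realType) (n : nat) (K : set 'cV[R]_n) : Prop :=
  forall (a : R) (x : 'cV[R]_n), 0 < a -> K x -> K (a *: x).

Definition pointed (R : realType) (n : nat) (K : set 'cV[R]_n) : Prop :=
  forall x : 'cV[R]_n, K x -> K (- x) -> x = 0.

Definition proper_cone (R : realType) (n : nat) (K : set 'cV[R]_n) : Prop :=
  [/\ is_cone K, convex_set K, closed K, pointed K & interior K !=set0].

Definition dual_cone (R : realType) (n : nat) (K : set 'cV[R]_n) :
    set 'cV[R]_n :=
  [set y | forall x, K x -> 0 <= inner x y].

Definition subdual (R : realType) (n : nat) (K : set 'cV[R]_n) : Prop :=
  K `<=` dual_cone K.

(* Quasi-convexity on D of a function known only through its values on D. *)
Definition quasiconvex (R : realType) (E : lmodType R) (D : set E)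
    (f : E -> R) : Prop :=
  forall c : R, convex_set (D `&` [set x | f x <= c]).

(* Unit tangent vector at x pointing towards y (for y <> x, - x). *)
Definition direction (R : realType) (n : nat) (x y : 'cV[R]_n) : 'cV[R]_n :=
  (enorm (y - inner x y *: x))^-1 *: (y - inner x y *: x).

(* acos <x, y> is the length of the shorter great-circle arc from x to y; the
   path is meaningful for x, y on the sphere with y <> x, - x and t in [0, 1]. *)
Definition minimal_geodesic (R : realType) (n : nat) (x y : 'cV[R]_n)
    (t : R) : 'cV[R]_n :=
  cos (t * acos (inner x y)) *: x + sin (t * acos (inner x y)) *: direction x y.

Definition spherically_quasiconvex (R : realType) (n : nat)
    (S : set 'cV[R]_n) (f : 'cV[R]_n -> R) : Prop :=
  forall x y : 'cV[R]_n, sphere x -> sphere y -> y <> x -> y <> - x ->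
    minimal_geodesic x y @` `[0, 1] `<=` S ->
    quasiconvex (E := R^o) `[0, 1] (f \o minimal_geodesic x y).

Definition quad_form (R : realType) (n : nat) (A : 'M[R]_n) (x : 'cV[R]_n) : R :=
  inner (A *m x) x.

Definition rayleigh (R : realType) (n : nat) (A : 'M[R]_n) (x : 'cV[R]_n) : R :=
  inner (A *m x) x / enorm x ^+ 2.

(* Main.v *)
Require Import Defs.
From mathcomp Require Import all_boot all_order all_algebra.
From mathcomp Require Import all_classical all_reals all_analysis.
From mathcomp Require Import ring lra.
Set Implicit Arguments.
Unset Strict Implicit.
Unset Printing Implicit Defensive.

Import numFieldNormedType.Exports.
Import Order.TTheory GRing.Theory Num.Theory.
Local Open Scope classical_set_scope.
Local Open Scope ring_scope.

(** The Rayleigh quotient phi_A is constant along open rays and agrees with q_A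
    on the unit sphere, so only the rays met by a path matter. Up to positive
    scaling, a minimal geodesic and the chord joining its endpoints meet the
    same rays. With theta the angle between the endpoints,

      sin((t - s) theta) g(r) = sin((t - r) theta) g(s) + sin((r - s) theta) g(t)

    along the geodesic g ([minimal_geodesic_comb]). As 0 < theta < pi, for
    s < r < t all three coefficients are positive, so g(r) is a positive
    combination of g(s) and g(t) ([minimal_geodesic_between]). Conversely, by
    the intermediate value theorem, the ray of any positive combination of the
    endpoints is met by g ([minimal_geodesic_meets_ray]).

    The interior of a convex cone is closed under positive combinations, and on
    it quasi-convexity of a function constant along open rays can be tested on
    arbitrary positive combinations ([quasiconvex_coneP]). The first
    correspondence then turns quasi-convexity of phi_A into that of q_A along
    geodesics. For the other direction, two points of the interior are
    normalised; the two unit vectors are not opposite because the cone is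
    pointed, the geodesic joining them stays in the interior, and it meets the
    ray of the given combination. *)

(** * Inner product and norm *)

Lemma innerC (R : realType) (n : nat) (x y : 'cV[R]_n) : inner x y = inner y x.
Proof. by apply: eq_bigr => i _; rewrite mulrC. Qed.

Lemma innerDl (R : realType) (n : nat) (x y z : 'cV[R]_n) :
  inner (x + y) z = inner x z + inner y z.
Proof. by rewrite -big_split; apply: eq_bigr => i _; rewrite mxE mulrDl. Qed.

Lemma innerZl (R : realType) (n : nat) (a : R) (x z : 'cV[R]_n) :
  inner (a *: x) z = a * inner x z.
Proof. by rewrite /inner mulr_sumr; apply: eq_bigr => i _; rewrite mxE mulrA. Qed.

Lemma innerDr (R : realType) (n : nat) (x y z : 'cV[R]_n) :
  inner z (x + y) = inner z x + inner z y.
Proof. by rewrite innerC innerDl !(innerC _ z). Qed.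

Lemma innerZr (R : realType) (n : nat) (a : R) (x z : 'cV[R]_n) :
  inner z (a *: x) = a * inner z x.
Proof. by rewrite innerC innerZl innerC. Qed.

Lemma inner_ge0 (R : realType) (n : nat) (x : 'cV[R]_n) : 0 <= inner x x.
Proof. by apply: sumr_ge0 => i _; rewrite -expr2 sqr_ge0. Qed.

Lemma inner_eq0 (R : realType) (n : nat) (x : 'cV[R]_n) :
  inner x x = 0 -> x = 0.
Proof.
move=> /eqP; rewrite psumr_eq0 => [/allP h|i _]; last by rewrite -expr2 sqr_ge0.
apply/matrixP => i j; rewrite (ord1 j) mxE.
by have := h i (mem_index_enum _); rewrite mulf_eq0 orbb => /eqP.
Qed.

Lemma enorm_sqr (R : realType) (n : nat) (x : 'cV[R]_n) :
  enorm x ^+ 2 = inner x x.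
Proof. by rewrite sqr_sqrtr // inner_ge0. Qed.

Lemma enorm_gt0 (R : realType) (n : nat) (x : 'cV[R]_n) :
  x <> 0 -> 0 < enorm x.
Proof.
move=> x0; rewrite sqrtr_gt0 lt_neqAle inner_ge0 andbT eq_sym.
by apply/eqP => /inner_eq0.
Qed.

Lemma sphereE (R : realType) (n : nat) (x : 'cV[R]_n) :
  sphere x <-> inner x x = 1.
Proof.
split=> [h|h]; first by rewrite -enorm_sqr h expr1n.
by rewrite /sphere /= /enorm h sqrtr1.
Qed.

Lemma sphere_normalize (R : realType) (n : nat) (x : 'cV[R]_n) :
  x <> 0 -> sphere ((enorm x)^-1 *: x).
Proof.
move=> /enorm_gt0 x0; apply/sphereE.
rewrite innerZl innerZr -enorm_sqr; field; exact: lt0r_neq0.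
Qed.

(** Both the numerator and the denominator are quadratic. *)
Lemma rayleighZ (R : realType) (n : nat) (A : 'M[R]_n) (a : R) (x : 'cV[R]_n) :
  0 < a -> rayleigh A (a *: x) = rayleigh A x.
Proof.
move=> /lt0r_neq0 a0; rewrite /rayleigh !enorm_sqr -scalemxAr.
rewrite !innerZl !innerZr !mulrA -expr2 invfM mulrACA divff ?mul1r //.
by rewrite expf_neq0.
Qed.

Lemma rayleigh_sphere (R : realType) (n : nat) (A : 'M[R]_n) (x : 'cV[R]_n) :
  sphere x -> rayleigh A x = quad_form A x.
Proof. by move=> sx; rewrite /rayleigh sx expr1n divr1. Qed.

(** * Quasi-convexity and convex cones *)

(** The weights 0 and 1 are dropped: they give back the endpoints. *)
Lemma quasiconvexP (R : realType) (E : lmodType R) (D : set E) (f : E -> R) :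
  quasiconvex D f <->
  forall c a b x y, 0 < a -> 0 < b -> a + b = 1 -> D x -> D y ->
    f x <= c -> f y <= c -> D (a *: x + b *: y) /\ f (a *: x + b *: y) <= c.
Proof.
split=> [h c a b x y a0 b0 ab Dx Dy fx fy | h c].
  have a0' : 0 <= a := ltW a0.
  have a1 : a <= 1 by lra.
  have := h c x y (Itv01 a0' a1).
  rewrite !inE => /(_ (conj Dx fx) (conj Dy fy)).
  suff -> : conv (Itv01 a0' a1) (x : convex_lmodType E) y = a *: x + b *: y by [].
  by rewrite (_ : b = 1 - a) //; lra.
apply/convex_setW => x y; rewrite !inE => -[Dx fx] [Dy fy] k k0 k1.
rewrite inE; apply: (h c k%:num (1 - k%:num)) => //; lra.
Qed.

(** [x + y] is twice the midpoint of [x] and [y]. *)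
Lemma convex_cone_add (R : realType) (n : nat) (K : set 'cV[R]_n) x y :
  is_cone K -> convex_set K -> K x -> K y -> K (x + y).
Proof.
move=> cK vK Kx Ky.
have h0 : 0 <= 2^-1 :> R by lra.
have h1 : 2^-1 <= 1 :> R by lra.
have := vK x y (Itv01 h0 h1); rewrite !inE => /(_ Kx Ky) h.
have := cK 2 _ _ h; rewrite [conv _ _ _](_ : _ = 2^-1 *: x + 2^-1 *: y); last first.
  by congr (_ + _ *: _); rewrite /unstable.onem /=; lra.
by rewrite scalerDr !scalerA divff ?pnatr_eq0 // !scale1r; apply; lra.
Qed.

(** Scaling by [a] is a homeomorphism that maps [K] into itself. *)
Lemma interior_cone_scale (R : realType) (n : nat) (K : set 'cV[R]_n) a x :
  is_cone K -> 0 < a -> interior K x -> interior K (a *: x).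
Proof.
move=> cK a0 /(nbhsZ (lt0r_neq0 a0)).
by apply: filterS => _ [y Ky <-]; apply: cK.
Qed.

(** The translate by [x] of a neighbourhood of [y] inside [K] stays in [K]. *)
Lemma interior_cone_add (R : realType) (n : nat) (K : set 'cV[R]_n) x y :
  is_cone K -> convex_set K ->
  interior K x -> interior K y -> interior K (x + y).
Proof.
move=> cK vK /interior_subset Kx /(nbhsB x).
by apply: filterS => _ [z Kz <-]; apply: convex_cone_add.
Qed.

(** For a function constant along open rays, the weights of a convex combination
    need not be normalised. *)
Lemma quasiconvex_coneP (R : realType) (E : lmodType R) (C : set E)
    (f : E -> R) :
  (forall a x, 0 < a -> C x -> C (a *: x)) ->
  (forall x y, C x -> C y -> C (x + y)) ->
  (forall a x, 0 < a -> f (a *: x) = f x) ->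
  quasiconvex C f <->
  forall c a b x y, 0 < a -> 0 < b -> C x -> C y ->
    f x <= c -> f y <= c -> f (a *: x + b *: y) <= c.
Proof.
move=> CZ CD fZ; split=> [/quasiconvexP h c a b x y a0 b0 Cx Cy fx fy | h].
  have s0 : 0 < a + b by lra.
  have v0 : 0 < (a + b)^-1 by rewrite invr_gt0.
  rewrite -(fZ (a + b)^-1) // scalerDr !scalerA.
  apply: (h c _ _ x y _ _ _ Cx Cy fx fy).2; rewrite ?mulr_gt0 //.
  by rewrite -mulrDr mulVf ?lt0r_neq0.
apply/quasiconvexP => c a b x y a0 b0 _ Cx Cy fx fy.
by split; [apply: CD; apply: CZ | apply: h].
Qed.

(** * Minimal geodesics *)

(** Pythagoras: the component of [y] orthogonal to [x] has squared length
    [1 - cos^2 theta]. The bounds on [inner x y], the unit length of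
    [direction x y] and the arrival of the geodesic at [y] all come from this. *)
Lemma inner_rejection (R : realType) (n : nat) (x y : 'cV[R]_n) :
  sphere x -> sphere y ->
  inner (y - inner x y *: x) (y - inner x y *: x) = 1 - inner x y ^+ 2.
Proof.
move=> /sphereE xx /sphereE yy.
rewrite -scaleNr !innerDl !innerDr !innerZl !innerZr xx yy (innerC y x); ring.
Qed.

(** The rejection of [y] from [x] vanishes only if [y] is a multiple of [x],
    that is, [x] or [- x] since both are unit vectors. *)
Lemma inner_sphere_itv (R : realType) (n : nat) (x y : 'cV[R]_n) :
  sphere x -> sphere y -> y <> x -> y <> - x -> -1 < inner x y < 1.
Proof.
move=> sx sy yx yNx; have e := inner_rejection sx sy.
have h := inner_ge0 (y - inner x y *: x); rewrite e in h.
have h1 : 1 - inner x y ^+ 2 <> 0.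
  rewrite -e => /inner_eq0 /eqP; rewrite subr_eq0 => /eqP yE.
  move/sphereE: (sy); rewrite {1}yE innerZl => /eqP.
  rewrite -expr2 sqrf_eq1 => /orP[] /eqP c; move: yE; rewrite c.
    by rewrite scale1r.
  by rewrite scaleN1r.
by apply/andP; split; nra.
Qed.

Lemma acos_inner_itv (R : realType) (n : nat) (x y : 'cV[R]_n) :
  sphere x -> sphere y -> y <> x -> y <> - x -> 0 < acos (inner x y) < pi.
Proof.
move=> sx sy yx yNx.
have /andP[c0 c1] := inner_sphere_itv sx sy yx yNx.
by rewrite acos_gt0 ?acos_ltpi // ?c0 ?c1 ?(ltW c0) ?(ltW c1).
Qed.

Lemma minimal_geodesic0 (R : realType) (n : nat) (x y : 'cV[R]_n) :
  minimal_geodesic x y 0 = x.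
Proof. by rewrite /minimal_geodesic mul0r cos0 sin0 scale1r scale0r addr0. Qed.

Lemma minimal_geodesic1 (R : realType) (n : nat) (x y : 'cV[R]_n) :
  sphere x -> sphere y -> y <> x -> y <> - x -> minimal_geodesic x y 1 = y.
Proof.
move=> sx sy yx yNx.
have /andP[c0 c1] := inner_sphere_itv sx sy yx yNx.
have c01 : -1 <= inner x y <= 1 by rewrite !ltW.
rewrite /minimal_geodesic mul1r acosK ?in_itv //= sin_acos // /direction.
rewrite /enorm inner_rejection // scalerA divff ?scale1r.
  by rewrite addrCA subrr addr0.
by rewrite sqrtr_eq0 -ltNge; nra.
Qed.

Lemma minimal_geodesic_sphere (R : realType) (n : nat) (x y : 'cV[R]_n) t :
  sphere x -> sphere y -> y <> x -> y <> - x -> sphere (minimal_geodesic x y t).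
Proof.
move=> sx sy yx yNx.
have /andP[c0 c1] := inner_sphere_itv sx sy yx yNx.
have e := inner_rejection sx sy.
have dd : sphere (direction x y).
  by apply: sphere_normalize => h; move: e; rewrite h {1}/inner big1; [nra|];
    move=> i _; rewrite mxE mul0r.
move: sx dd => /sphereE xx /sphereE dd; apply/sphereE.
have xd : inner x (direction x y) = 0.
  rewrite /direction innerZr -scaleNr innerDr innerZr xx mulr1 subrr.
  by rewrite mulr0.
rewrite /minimal_geodesic; move: (direction x y) dd xd => d dd xd.
rewrite !innerDl !innerDr !innerZl !innerZr dd xx (innerC d x) xd !mulr1.
rewrite -(cos2Dsin2 (t * acos (inner x y))); ring.
Qed.

(** Any three points of the trajectory [cos u *: x + sin u *: d] lie in a plane;
    the coefficients of their linear relation come from the subtraction formula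
    for the sine. *)
Lemma minimal_geodesic_comb (R : realType) (n : nat) (x y : 'cV[R]_n) s r t :
  let theta := acos (inner x y) in
  sin ((t - s) * theta) *: minimal_geodesic x y r =
  sin ((t - r) * theta) *: minimal_geodesic x y s +
  sin ((r - s) * theta) *: minimal_geodesic x y t.
Proof.
move=> theta; rewrite /minimal_geodesic -/theta.
move: (direction x y) => d; rewrite !scalerDr !scalerA.
rewrite addrACA -!scalerDl !mulrBl !sinB.
by congr (_ *: _ + _ *: _); ring.
Qed.

Lemma sin_gap_gt0 (R : realType) (theta s t : R) :
  0 < theta < pi -> 0 <= s -> s < t -> t <= 1 -> 0 < sin ((t - s) * theta).
Proof. by move=> /andP[h0 h1] s0 st t1; apply: sin_gt0_pi; apply/andP; split; nra. Qed.

(** All angles of [minimal_geodesic_comb] lie in [(0, pi)], where the sine is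
    positive. *)
Lemma minimal_geodesic_between (R : realType) (n : nat) (x y : 'cV[R]_n) s r t :
  sphere x -> sphere y -> y <> x -> y <> - x ->
  0 <= s -> s < r -> r < t -> t <= 1 ->
  exists a b, [/\ 0 < a, 0 < b & minimal_geodesic x y r =
    a *: minimal_geodesic x y s + b *: minimal_geodesic x y t].
Proof.
move=> sx sy yx yNx s0 sr rt t1.
have th := acos_inner_itv sx sy yx yNx.
have st := lt_trans sr rt.
have h0 := sin_gap_gt0 th s0 st t1.
have h1 := sin_gap_gt0 th (le_trans s0 (ltW sr)) rt t1.
have h2 := sin_gap_gt0 th s0 sr (le_trans (ltW rt) t1).
have e := minimal_geodesic_comb x y s r t; rewrite /= in e.
set d := sin ((t - s) * _) in h0 e.
exists (d^-1 * sin ((t - r) * acos (inner x y))),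
  (d^-1 * sin ((r - s) * acos (inner x y))).
split; [by rewrite mulr_gt0 ?invr_gt0 | by rewrite mulr_gt0 ?invr_gt0 |].
by rewrite -!scalerA -scalerDr -e scalerA mulVf ?scale1r ?lt0r_neq0.
Qed.

(** By [minimal_geodesic_comb] the geodesic at time [t] is proportional to
    [sin ((1 - t) theta) *: x + sin (t theta) *: y]. Its ray is that of
    [a *: x + b *: y] when [a * sin (t theta) = b * sin ((1 - t) theta)], and
    the difference of the two sides changes sign on [[0, 1]]. *)
Lemma minimal_geodesic_meets_ray (R : realType) (n : nat) (x y : 'cV[R]_n) a b :
  sphere x -> sphere y -> y <> x -> y <> - x -> 0 < a -> 0 < b ->
  exists t k, [/\ 0 < t < 1, 0 < k &
    a *: x + b *: y = k *: minimal_geodesic x y t].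
Proof.
move=> sx sy yx yNx a0 b0.
have th := acos_inner_itv sx sy yx yNx; set theta := acos _ in th.
pose g t := a * sin (t * theta) - b * sin ((1 - t) * theta).
have sth : 0 < sin theta by exact: sin_gt0_pi.
have g0 : g 0 = - (b * sin theta).
  by rewrite /g mul0r sin0 mulr0 sub0r subr0 mul1r.
have g1 : g 1 = a * sin theta.
  by rewrite /g subrr mul0r sin0 mulr0 subr0 mul1r.
have cg : continuous g.
  move=> t; apply: cvgB; apply: cvgM; try exact: cvg_cst.
    apply: continuous_comp; last exact: continuous_sin.
    by apply: cvgM; [exact: cvg_id | exact: cvg_cst].
  apply: continuous_comp; last exact: continuous_sin.
  apply: cvgM; last exact: cvg_cst.
  by apply: cvgB; [exact: cvg_cst | exact: cvg_id].
have [t t01 gt0] : exists2 t, t \in `[0, 1] & g t = 0.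
  apply: IVT; [exact: ler01 | exact: continuous_subspaceT |].
  have asth : 0 < a * sin theta by apply: mulr_gt0.
  have bsth : 0 < b * sin theta by apply: mulr_gt0.
  rewrite g0 g1 ge_min le_max; apply/andP; split; apply/orP; [left|right]; lra.
move: t01; rewrite in_itv /= => /andP[t0 t1].
have tlt : 0 < t.
  rewrite lt_neqAle t0 andbT; apply/eqP => e.
  by move: gt0; rewrite -e g0; nra.
have tlt1 : t < 1.
  rewrite lt_neqAle t1 andbT; apply/eqP => e.
  by move: gt0; rewrite e g1; nra.
have s0 : 0 < sin (t * theta).
  by rewrite -[t]subr0; apply: sin_gap_gt0.
have comb := minimal_geodesic_comb x y 0 t 1.
rewrite /= minimal_geodesic0 minimal_geodesic1 // !subr0 mul1r -/theta in comb.
(* This multiple makes the coefficient of [y] equal to [b]. *)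
exists t, (b / sin (t * theta) * sin theta).
split; [by rewrite tlt tlt1 | by rewrite mulr_gt0 ?divr_gt0 |].
rewrite -scalerA comb scalerDr !scalerA divfK ?lt0r_neq0 //.
congr (_ *: _ + _); apply: (mulIf (lt0r_neq0 s0)).
rewrite mulrAC divfK ?lt0r_neq0 //; move: gt0; rewrite /g; lra.
Qed.

Theorem theorem5p2p1 (R : realType) (n : nat) (K : set 'cV[R]_n) (A : 'M[R]_n)
    (hK : proper_cone K) (hsub : subdual K) (hA : A = A^T) :
  spherically_quasiconvex (@sphere R n `&` interior K) (quad_form A) <->
  quasiconvex (interior K) (rayleigh A).
Proof.
case: hK => cK vK _ pK _.
have intZ a x : 0 < a -> interior K x -> interior K (a *: x).
  exact: interior_cone_scale.
have intD x y : interior K x -> interior K y -> interior K (x + y).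
  exact: interior_cone_add.
have rayZ a x : 0 < a -> rayleigh A (a *: x) = rayleigh A x.
  exact: rayleighZ.
apply: iff_trans (iff_sym (quasiconvex_coneP _ _ _)) => //.
split=> [hs c a b x y a0 b0 Kx Ky fx fy | hq x y sx sy yx yNx geoS].
  (* The origin has no direction, but then the combination stays on one ray. *)
  have [->|/eqP x0] := eqVneq x 0; first by rewrite scaler0 add0r rayZ.
  have [->|/eqP y0] := eqVneq y 0; first by rewrite scaler0 addr0 rayZ.
  (* Normalise, so that the combination is one of two points of the sphere. *)
  pose u := (enorm x)^-1 *: x; pose v := (enorm y)^-1 *: y.
  have nx := enorm_gt0 x0; have ny := enorm_gt0 y0.
  have su : sphere u by exact: sphere_normalize.
  have sv : sphere v by exact: sphere_normalize.
  have Ku : interior K u by apply: intZ; rewrite ?invr_gt0.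
  have Kv : interior K v by apply: intZ; rewrite ?invr_gt0.
  have fu : rayleigh A u <= c by rewrite rayZ ?invr_gt0.
  have fv : rayleigh A v <= c by rewrite rayZ ?invr_gt0.
  have -> : a *: x = (a * enorm x) *: u by rewrite scalerA mulfK ?lt0r_neq0.
  have -> : b *: y = (b * enorm y) *: v by rewrite scalerA mulfK ?lt0r_neq0.
  have [vu|/eqP vu] := eqVneq v u.
    by rewrite vu -scalerDl rayZ // addr_gt0 ?mulr_gt0.
  have vNu : v <> - u.
    move=> e; have u0 : u = 0 by apply: pK; [|rewrite -e]; exact: interior_subset.
    move/sphereE: su; rewrite u0 -(scale0r 0) innerZl mul0r => /esym /eqP.
    by rewrite oner_eq0.
  have [t [k [t01 k0 ->]]] := minimal_geodesic_meets_ray su sv vu vNu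
    (mulr_gt0 a0 nx) (mulr_gt0 b0 ny).
  have sg r : sphere (minimal_geodesic u v r) by exact: minimal_geodesic_sphere.
  have geoS : minimal_geodesic u v @` `[0, 1] `<=` @sphere R n `&` interior K.
    move=> _ [r /= + <-]; rewrite in_itv /= => /andP[r0 r1].
    split=> //.
    have [->|r0'] := eqVneq r 0; first by rewrite minimal_geodesic0.
    have [->|r1'] := eqVneq r 1; first by rewrite minimal_geodesic1.
    have r0lt : 0 < r by rewrite lt_neqAle eq_sym r0'.
    have r1lt : r < 1 by rewrite lt_neqAle r1'.
    have [p [q [p0 q0 ->]]] :=
      minimal_geodesic_between su sv vu vNu (lexx 0) r0lt r1lt (lexx 1).
    by rewrite minimal_geodesic0 minimal_geodesic1 //; apply: intD; apply: intZ.
  rewrite rayZ // rayleigh_sphere //.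
  have /quasiconvexP qc := hs u v su sv vu vNu geoS.
  move/andP: t01 => [t0 t1].
  have I0 : `[0, 1]%classic (0 : R) by rewrite /= in_itv /= lexx ler01.
  have I1 : `[0, 1]%classic (1 : R) by rewrite /= in_itv /= lexx ler01.
  have := qc c (1 - t) t 0 1 _ t0 (subrK _ _) I0 I1.
  rewrite /= minimal_geodesic0 minimal_geodesic1 // -(rayleigh_sphere A su).
  rewrite -(rayleigh_sphere A sv) subr_gt0 => /(_ t1 fu fv) [_].
  by rewrite scaler0 add0r /GRing.scale /= mulr1.
apply/quasiconvexP => c.
have between s r t : 0 <= s -> s < r -> r < t -> t <= 1 ->
    quad_form A (minimal_geodesic x y s) <= c ->
    quad_form A (minimal_geodesic x y t) <= c ->
    quad_form A (minimal_geodesic x y r) <= c.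
  move=> s0 sr rt t1 fs ft.
  have st := lt_trans sr rt.
  have [p [q [p0 q0 e]]] :=
    minimal_geodesic_between sx sy yx yNx s0 sr rt t1.
  have sg t' : sphere (minimal_geodesic x y t').
    exact: minimal_geodesic_sphere.
  rewrite -rayleigh_sphere // e; apply: hq => //; rewrite ?rayleigh_sphere //.
    by apply: (geoS _ _).2; exists s => //=;
      rewrite in_itv /= s0 ltW ?(lt_le_trans st).
  by apply: (geoS _ _).2; exists t => //=;
    rewrite in_itv /= t1 ltW ?(le_lt_trans s0).
(* Unfolds the scaling of [R] as a module over itself into multiplication. *)
suff conv01 a b (s t : R) : 0 < a -> 0 < b -> a + b = 1 ->
    `[0, 1]%classic s -> `[0, 1]%classic t ->
    quad_form A (minimal_geodesic x y s) <= c ->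
    quad_form A (minimal_geodesic x y t) <= c ->
    `[0, 1]%classic (a * s + b * t) /\
    quad_form A (minimal_geodesic x y (a * s + b * t)) <= c.
  exact: conv01.
move=> a0 b0 ab; rewrite /= !in_itv /=.
move=> /andP[s0 s1] /andP[t0 t1] fs ft.
split; first by apply/andP; split; nra.
have bE : b = 1 - a by lra.
have [st|ts|<-] := ltgtP s t.
- by apply: (between s _ t) => //; rewrite bE; nra.
- by apply: (between t _ s) => //; rewrite bE; nra.
- by rewrite -mulrDl ab mul1r.
Qed.
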